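(* Fix $\alpha\in\mathbb{R}\setminus[0,1]$ and let $f_\alpha(x)=x^\alpha-1$. Let $\mu$ be a measure on a sample space $\mathcal{X}$, let $P$ and $\{Q_\xi:\xi\in\Xi\}$ be probability measures on $\mathcal{X}$ having densities $p$ and $\{q_\xi:\xi\in\Xi\}$ with respect to $\mu$, let $\nu$ be an arbitrary probability measure on $\Xi$, and let $\bar Q$ be the probability measure on $\mathcal{X}$ with density $\bar q=\int_\Xi q_\xi\,\nu(\mathrm{d}\xi)$ with respect to $\mu$. Then $$D_{f_\alpha}(P\|\bar Q)\le\left[\int_\Xi\big(D_{f_\alpha}(P\|Q_\xi)+1\big)^{1/(1-\alpha)}\nu(\mathrm{d}\xi)\right]^{1-\alpha}-1.$$ Moreover, if $\mathcal{P}=\{P_\theta:\theta\in\Theta\}$ is a family of probability measures on $\mathcal{X}$, each dominated by $\mu$, and $w$ is a probability measure on $\Theta$, then $$I_{f_\alpha}(w,\mathcal{P})\le\int_\Theta\left[\int_\Xi\big(D_{f_\alpha}(P_\theta\|Q_\xi)+1\big)^{1/(1-\alpha)}\nu(\mathrm{d}\xi)\right]^{1-\alpha}w(\mathrm{d}\theta)-1.$$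
   Context: All functions and sets are assumed measurable as needed. For convex $f:(0,\infty)\to\mathbb{R}$ with $f(1)=0$, put $f(0):=\lim_{x\downarrow0}f(x)$ and $f'(\infty):=\lim_{x\uparrow\infty}f(x)/x$ (possibly $+\infty$). For probability measures $P,Q$ with densities $p,q$ with respect to a common measure $\mu$, $D_f(P\|Q):=\int f(p/q)\,q\,\mathrm{d}\mu+f'(\infty)P\{q=0\}$, with the convention $0\cdot\infty=0$. The $f$-informativity is $I_f(w,\mathcal{P}):=\inf_Q\int_\Theta D_f(P_\theta\|Q)\,w(\mathrm{d}\theta)$, the infimum being over all probability measures $Q$ on $\mathcal{X}$. Powers of extended nonnegative numbers follow the usual conventions: $\infty^{s}=\infty$ and $0^s=0$ for $s>0$; $\infty^s=0$ and $0^s=\infty$ for $s<0$. *)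

(* Defs.v *)
From HB Require Import structures.
From mathcomp Require Import all_boot all_order all_algebra.
From mathcomp Require Import all_classical all_reals all_analysis.
From mathcomp Require Import measurable_realfun.

Set Implicit Arguments.
Unset Strict Implicit.
Unset Printing Implicit Defensive.

Import Order.TTheory GRing.Theory Num.Theory.
Import numFieldNormedType.Exports.

Local Open Scope classical_set_scope.
Local Open Scope ring_scope.
Local Open Scope charge_scope.
Local Open Scope ereal_scope.

(* Densities are allowed to take the value +oo, because a mixture
   \int[nu]_xi q xi x of real-valued densities may do so on a null set. *)
Definition is_density d (X : measurableType d) (R : realType)
    (mu : {measure set X -> \bar R}) (p : X -> \bar R) (P : probability X R) :=
  [/\ measurable_fun [set: X] p,
      forall x, 0 <= p x &
      forall A, measurable A -> P A = \int[mu]_(x in A) p x].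

(* The library's poweR sends 0 to 0 and +oo to +oo for every nonzero exponent,
   whereas here 0 `^ s = +oo and +oo `^ s = 0 when s < 0.  Recall that
   0^-1 = +oo and +oo^-1 = 0 in \bar R. *)
Definition epow (R : realType) (x : \bar R) (s : R) : \bar R :=
  if (s < 0)%R then (poweR x (- s))^-1 else poweR x s.

Section f_divergence.
Context {R : realType}.
Variable f : R -> R.

Definition f_at0 : \bar R := lim ((f x)%:E @[x --> (0 : R)^'+]).

Definition f_slope_oo : \bar R := lim ((f x / x)%:E @[x --> +oo%R]).

Definition f_ext (x : R) : \bar R := if x == 0%R then f_at0 else (f x)%:E.

(* At points where q = 0 the integrand is f_ext _ * 0 = 0, as 0 * +oo = 0 in
   \bar R. *)
Definition fdiv_density d (X : measurableType d)
    (mu : {measure set X -> \bar R}) (P : set X -> \bar R) (p q : X -> R) :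
    \bar R :=
  \int[mu]_x (f_ext (p x / q x)%R * (q x)%:E)
  + f_slope_oo * P [set x | q x = 0%R].

End f_divergence.

Section sum_of_probabilities.
Context d (X : measurableType d) (R : realType) (P Q : probability X R).

Definition psum : set X -> \bar R := measure_add P Q.

HB.instance Definition _ := Measure.on psum.

Let psum_finite : fin_num_fun psum.
Proof.
by move=> A mA; rewrite /psum measure_addE fin_numD !fin_num_measure.
Qed.

HB.instance Definition _ := Measure_isFinite.Build _ _ _ psum psum_finite.

End sum_of_probabilities.

(* The f-divergence does not depend on the dominating measure nor on the
   versions of the densities; P + Q dominates both P and Q whatever P and Q
   are, and the densities are Radon-Nikodym derivatives with respect to it. *)
Definition fdiv (R : realType) (f : R -> R) d (X : measurableType d)
    (P Q : probability X R) : \bar R :=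
  fdiv_density f (psum P Q) P
    (fun x => fine (('d (charge_of_finite_measure P) '/d (psum P Q)) x))
    (fun x => fine (('d (charge_of_finite_measure Q) '/d (psum P Q)) x)).

Definition f_informativity (R : realType) (f : R -> R)
    dT (Theta : measurableType dT) (w : probability Theta R)
    d (X : measurableType d) (P : Theta -> probability X R) : \bar R :=
  ereal_inf [set \int[w]_theta fdiv f (P theta) Q | Q in [set: probability X R]].

(* Only the values on the open half-line matter; for alpha < 0 the value at 0
   is the limit +oo given by f_at0, not powR 0 alpha - 1. *)
Definition f_alpha (R : realType) (alpha : R) (x : R) : R :=
  (powR x alpha - 1)%R.

(* Main.v *)
Require Import Defs.
From HB Require Import structures.
From mathcomp Require Import all_boot all_order all_algebra.
From mathcomp Require Import all_classical all_reals all_analysis.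
From mathcomp Require Import measurable_realfun. 
From mathcomp Require Import ring lra.

Import Order.TTheory GRing.Theory Num.Theory.
Import numFieldNormedType.Exports.

Local Open Scope classical_set_scope.
Local Open Scope ring_scope.
Local Open Scope ereal_scope.

Set Implicit Arguments.
Unset Strict Implicit.
Unset Printing Implicit Defensive.

(** With [hellinger alpha a b] = [a^alpha b^(1 - alpha)], the divergence of order
    [alpha] is, up to the constant 1, the Hellinger integral
      [D(P || Q) + 1 = \int hellinger alpha (dP/dlam) (dQ/dlam) dlam],
    for any measure [lam] for which both densities exist ([fdiv_hellinger]):
    the integrand is homogeneous of degree 1, so changing the base measure
    changes nothing.

    For fixed [P], the Hellinger integral raised to the power [1 / (1 - alpha)]
    is, as a function of the density of [Q], an [L^(1 - alpha)] norm with respect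
    to the weight [p^alpha].  The bound is Minkowski's integral inequality when
    [1 - alpha > 1], and its reverse when [1 - alpha < 0]; raising the reverse
    inequality to the negative power [1 - alpha] restores the direction.
    Both cases have one proof ([hellinger_mixture]).  Outside of [0, 1] the
    integrand is jointly convex, so by homogeneity
      [hellinger (\int A) (\int B) <= \int hellinger A B]  ([hellinger_jensen]).
    Put [M xi = D(P || Q xi) + 1], [N xi = (M xi)^(1/(1 - alpha))] and
    [n = \int N dnu].  Apply this at each point [x] to [A xi = p x * (N xi / n)],
    whose integral is [p x], and [B xi = q xi x], whose integral is the mixture
    density.  Integrating over [x], exchanging the integrals and using
    [M xi * (N xi)^alpha = N xi] yields
      [D(P || Qbar) + 1 <= n^(- alpha) * \int N dnu = n^(1 - alpha)].

    Two measure-theoretic points need care.  First, [mu] is arbitrary, so Tonelli's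
    theorem cannot be applied to it.  It is applied to [Qbar] instead: the
    relative densities [q xi / qbar] integrate to 1 over [xi] at [Qbar]-almost
    every point, while each of them integrates to at most 1 over [x]; hence
    almost all of them integrate to exactly 1, and then [Q xi] is [Qbar] times
    its relative density ([relative_density_exists]).  Secondly,
    [xi |-> D(P || Q xi)] is only known to agree with a measurable function
    outside a null set, and may be nonmeasurable on that set; for the integral
    of a nonnegative function, a supremum over simple functions below it, this
    is harmless ([ae_eq_integral_nonmeasurable]).

    The bound on the informativity follows by taking [Qbar] as a competitor in
    the infimum and integrating the first bound over [theta]. *)

(** * Powers of extended nonnegative numbers *)

Lemma epow_fin (R : realType) (x s : R) : (0 < x)%R -> epow x%:E s = (x `^ s)%:E.
Proof.
move=> x0; rewrite /epow; case: ifPn => // s0.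
by rewrite poweR_EFin inver gt_eqF ?powR_gt0// powRN invrK.
Qed.

Lemma epow_gt0E (R : realType) (x : \bar R) s : (0 < s)%R -> epow x s = poweR x s.
Proof. by move=> s0; rewrite /epow ltNge (ltW s0). Qed.

Lemma epow_ge0 (R : realType) (x : \bar R) s : 0 <= epow x s.
Proof. by rewrite /epow; case: ifP => _; rewrite ?inve_ge0 poweR_ge0. Qed.

Lemma epow0_pos (R : realType) (s : R) : (0 < s)%R -> epow 0 s = 0.
Proof. by move=> s0; rewrite epow_gt0E// poweR0r// gt_eqF. Qed.

Lemma epow0_neg (R : realType) (s : R) : (s < 0)%R -> epow 0 s = +oo.
Proof. by move=> s0; rewrite /epow s0 poweR0r ?inve0// oppr_eq0 lt_eqF. Qed.

Lemma epowy_pos (R : realType) (s : R) : (0 < s)%R -> epow +oo s = +oo.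
Proof. by move=> s0; rewrite epow_gt0E// poweRyr// gt_eqF. Qed.

Lemma epowy_neg (R : realType) (s : R) : (s < 0)%R -> epow +oo s = 0.
Proof. by move=> s0; rewrite /epow s0 poweRyr ?invey// oppr_eq0 lt_eqF. Qed.

Lemma epow1 (R : realType) (s : R) : epow 1 s = 1.
Proof. by rewrite epow_fin// powR1. Qed.

(** Restricted to real factors: for [s < 0] the identity fails at [0 * +oo], whose
    left-hand side is [0 `^ s = +oo] and right-hand side [+oo * 0 = 0]. *)
Lemma epowM (R : realType) (x y s : R) : (0 <= x)%R -> (0 <= y)%R ->
  epow (x * y)%:E s = epow x%:E s * epow y%:E s.
Proof.
rewrite le_eqVlt => /predU1P[<-|x0]; rewrite le_eqVlt => /predU1P[<-|y0].
- rewrite mul0r; case: (ltgtP s 0%R) => s0.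
  + by rewrite epow0_neg.
  + by rewrite epow0_pos// mule0.
  + by rewrite s0 /epow ltxx poweRe0 mule1.
- rewrite mul0r (epow_fin _ y0); case: (ltgtP s 0%R) => s0.
  + by rewrite epow0_neg// gt0_mulye// lte_fin powR_gt0.
  + by rewrite epow0_pos// mul0e.
  + by rewrite s0 /epow ltxx poweRe0 powRr0 mule1.
- rewrite mulr0 (epow_fin _ x0); case: (ltgtP s 0%R) => s0.
  + by rewrite epow0_neg// gt0_muley// lte_fin powR_gt0.
  + by rewrite epow0_pos// mule0.
  + by rewrite s0 /epow ltxx poweRe0 powRr0 mule1.
- by rewrite !epow_fin ?mulr_gt0// powRM ?ltW// EFinM.
Qed.

Lemma measurable_epow (R : realType) (s : R) :
  measurable_fun [set: \bar R] (fun x => epow x s).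
Proof.
have [s0|s0] := ltP s 0%R; last first.
  apply: (eq_measurable_fun (fun x : \bar R => poweR x s)).
    by move=> x _; rewrite /epow ltNge s0.
  exact: measurable_poweR.
pose g (x : \bar R) := if x == 0 then +oo else if x == -oo then +oo else
  if x == +oo then 0 else poweR x s.
apply: (eq_measurable_fun g).
  move=> x _; rewrite /g /epow s0.
  have Ns0 : (- s)%R != 0%R by rewrite oppr_eq0 lt_eqF.
  case: x => [r||]/=; last 2 first.
  - by rewrite oppr_eq0 (lt_eqF s0).
  - by rewrite oppr_eq0 (lt_eqF s0) inve0.
  rewrite eqe; case: ifPn => [/eqP ->|r0]; first by rewrite powR0// inve0.
  by rewrite inver powR_eq0 (negbTE r0)/= powRN invrK.
apply: measurable_fun_ifT; [exact: measurable_fun_eqe|by []|].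
apply: measurable_fun_ifT; [exact: measurable_fun_eqe|by []|].
apply: measurable_fun_ifT; [exact: measurable_fun_eqe|by []|].
exact: measurable_poweR.
Qed.

Lemma epow_le (R : realType) (x y : \bar R) (s : R) : (0 < s)%R -> 0 <= x -> x <= y ->
  epow x s <= epow y s.
Proof.
move=> s0 x0 xy; rewrite !epow_gt0E//.
by apply: gt0_ler_poweR; rewrite ?in_itv/= ?leey ?andbT ?(ltW s0)// (le_trans x0).
Qed.

Lemma epow_ge (R : realType) (x y : \bar R) (s : R) : (s < 0)%R -> 0 <= x -> x <= y ->
  epow y s <= epow x s.
Proof.
move=> s0 x0 xy; rewrite /epow s0 lee_pV2 ?inE ?poweR_ge0//.
by apply: gt0_ler_poweR; rewrite ?in_itv/= ?leey ?andbT ?oppr_ge0 ?(ltW s0)// (le_trans x0).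
Qed.

(** * The Hellinger integrand and its joint convexity *)

(** The perspective of [x `^ alpha]: the convention [0 * +oo = 0] gives it the
    value 0 at [(0, 0)] and the limits of the perspective elsewhere on the axes. *)
Definition hellinger (R : realType) (alpha a b : R) : \bar R :=
  epow a%:E alpha * epow b%:E (1 - alpha)%R.

(** Exchanging the arguments swaps [alpha > 1] and [alpha < 0], so that inequalities
    need only be proved for [alpha > 1]. *)
Lemma hellinger_sym (R : realType) (alpha a b : R) :
  hellinger (1 - alpha)%R b a = hellinger alpha a b.
Proof. by rewrite /hellinger subKr muleC. Qed.

Lemma hellinger_ge0 (R : realType) (alpha a b : R) : 0 <= hellinger alpha a b.
Proof. by rewrite mule_ge0 ?epow_ge0. Qed.

Lemma measurable_hellinger (R : realType) (alpha : R) d (T : measurableType d)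
    (D : set T) (f g : T -> R) :
  measurable_fun D f -> measurable_fun D g ->
  measurable_fun D (fun x => hellinger alpha (f x) (g x)).
Proof.
move=> mf mg; apply: emeasurable_funM.
  by apply: (measurableT_comp (measurable_epow _)); exact/measurable_EFinP.
by apply: (measurableT_comp (measurable_epow _)); exact/measurable_EFinP.
Qed.

Lemma notin_itv01P (R : realType) (alpha : R) : alpha \notin `[0%R, 1%R] ->
  (alpha < 0 \/ 1 < alpha)%R.
Proof.
rewrite in_itv/= negb_and -!ltNge => /orP[]; by [left|right].
Qed.

Lemma hellinger00 (R : realType) (alpha : R) : alpha \notin `[0%R, 1%R] ->
  hellinger alpha 0 0 = 0.
Proof.
move=> /notin_itv01P[a0|a1]; rewrite /hellinger.
  by rewrite (epow0_pos (s := (1 - alpha)%R)) ?mule0// subr_gt0 (lt_trans a0).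
by rewrite epow0_pos ?mul0e// (lt_trans _ a1).
Qed.

Lemma hellinger_homogeneous (R : realType) (alpha a b c : R) : alpha \notin `[0%R, 1%R] ->
  (0 <= a)%R -> (0 <= b)%R -> (0 <= c)%R ->
  hellinger alpha (a * c) (b * c) = hellinger alpha a b * c%:E.
Proof.
move=> ha a0 b0; rewrite le_eqVlt => /predU1P[<-|c0].
  by rewrite !mulr0 hellinger00// mule0.
rewrite /hellinger !epowM ?(ltW c0)//.
rewrite muleACA; congr (_ * _).
rewrite !epow_fin// -EFinM -powRD ?(gt_eqF c0) ?implybT//.
by rewrite addrC subrK powRr1// ltW.
Qed.

(** Young's inequality for the conjugate exponents [alpha] and [alpha / (alpha - 1)];
    equivalently, the graph of [z `^ alpha] lies above its tangent at [u]. *)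
Lemma young_powR (R : realType) (alpha z u : R) : (1 < alpha)%R ->
  (0 <= z)%R -> (0 <= u)%R ->
  (alpha * (u `^ (alpha - 1) * z) <= z `^ alpha + (alpha - 1) * u `^ alpha)%R.
Proof.
move=> a1 z0 u0.
have a0 : (0 < alpha)%R by lra.
have am0 : (0 < alpha - 1)%R by lra.
have := @conjugate_powR R z (u `^ (alpha - 1))%R alpha (alpha / (alpha - 1))%R z0
  (powR_ge0 _ _) a0.
rewrite divr_gt0// => /(_ isT).
have -> : (alpha^-1 + (alpha / (alpha - 1))^-1 = 1)%R.
  by field; rewrite !gt_eqF.
move=> /(_ erefl).
rewrite -powRrM mulrCA divff ?gt_eqF// mulr1 => H.
have : (alpha * (z * u `^ (alpha - 1)) <=
  alpha * (z `^ alpha / alpha + u `^ alpha / (alpha / (alpha - 1))))%R.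
  by rewrite ler_pM2l.
rewrite (mulrC z); congr (_ <= _)%R.
by field; rewrite !gt_eqF.
Qed.

(** Young's inequality at [z = x / y], multiplied by [y].  Keeping the term in [y]
    on the right makes it true on the axes as well. *)
Lemma hellinger_tangent (R : realType) (alpha x y u : R) : (1 < alpha)%R ->
  (0 <= x)%R -> (0 <= y)%R -> (0 <= u)%R ->
  (alpha * u `^ (alpha - 1) * x)%:E <=
  hellinger alpha x y + ((alpha - 1) * u `^ alpha * y)%:E.
Proof.
move=> a1; rewrite le_eqVlt => /predU1P[<- y0 u0|x0].
  rewrite mulr0 adde_ge0 ?hellinger_ge0// lee_fin !mulr_ge0 ?powR_ge0//.
  by rewrite subr_ge0 ltW.
rewrite le_eqVlt => /predU1P[<-|y0] u0.
  rewrite /hellinger (epow0_neg (s := (1 - alpha)%R)) ?subr_lt0// epow_fin//.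
  by rewrite gt0_muley ?lte_fin ?powR_gt0// mulr0 adde0 leey.
rewrite /hellinger !epow_fin// -EFinM -EFinD lee_fin.
have H := young_powR a1 (divr_ge0 (ltW x0) (ltW y0)) u0.
rewrite -(ler_pM2r y0) in H; move: H; congr (_ <= _)%R.
  by field; rewrite gt_eqF.
rewrite mulrDl powRM ?invr_ge0 ?ltW//; congr (_ + _)%R.
rewrite -mulrA; congr (_ * _)%R.
rewrite -(@powR_inv1 _ y) ?ltW// -powRrM mulN1r -[X in (_ * X)%R](@powRr1 _ y) ?ltW//.
by rewrite -powRD ?(gt_eqF y0) ?implybT// addrC.
Qed.

(** At the slope [u = a / b] the tangent of [hellinger_tangent] touches the graph
    at [(a, b)]. *)
Lemma tangent_at_ratio (R : realType) (alpha a b : R) : (0 < alpha)%R ->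
  (0 < a)%R -> (0 < b)%R ->
  (alpha * (a / b) `^ (alpha - 1) * a - (alpha - 1) * (a / b) `^ alpha * b =
  a `^ alpha * b `^ (1 - alpha))%R.
Proof.
move=> al0 a0 b0.
rewrite -(mulr_powRB1 (divr_ge0 (ltW a0) (ltW b0)) al0).
rewrite -(mulr_powRB1 (ltW a0) al0) powRM ?invr_ge0 ?ltW//.
have -> : (b^-1 `^ (alpha - 1) = b `^ (1 - alpha))%R.
  by rewrite -powR_inv1 ?(ltW b0)// -powRrM mulN1r opprB.
by field; rewrite gt_eqF.
Qed.

Section jensen.
Context (R : realType) d (T : measurableType d) (m : {measure set T -> \bar R}).
Variables (A B : T -> R).
Hypotheses (mA : measurable_fun [set: T] A) (mB : measurable_fun [set: T] B).
Hypotheses (A0 : forall x, (0 <= A x)%R) (B0 : forall x, (0 <= B x)%R).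

(** Integrating the tangent inequality of slope [u] bounds the right-hand side from
    below; the best slope is [u = a / b], and when [b = 0] the bounds tend to
    infinity with [u]. *)
Lemma hellinger_jensen_gt1 (alpha a b : R) : (1 < alpha)%R ->
  \int[m]_x (A x)%:E = a%:E -> \int[m]_x (B x)%:E = b%:E ->
  hellinger alpha a b <= \int[m]_x hellinger alpha (A x) (B x).
Proof.
move=> al1 IA IB.
have a0 : (0 <= a)%R by rewrite -lee_fin -IA integral_ge0// => x _; rewrite lee_fin.
have b0 : (0 <= b)%R by rewrite -lee_fin -IB integral_ge0// => x _; rewrite lee_fin.
have al0 : (0 < alpha)%R by rewrite (lt_trans _ al1).
have am0 : (0 < alpha - 1)%R by rewrite subr_gt0.
have tangent u : (0 <= u)%R -> (alpha * u `^ (alpha - 1) * a)%:E <=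
    \int[m]_x hellinger alpha (A x) (B x) + ((alpha - 1) * u `^ alpha * b)%:E.
  move=> u0.
  have c0 : (0 <= alpha * u `^ (alpha - 1))%R by rewrite mulr_ge0 ?powR_ge0// ltW.
  have e0 : (0 <= (alpha - 1) * u `^ alpha)%R by rewrite mulr_ge0 ?powR_ge0// ltW.
  rewrite EFinM -IA -ge0_integralZl//; last 2 first.
  - exact/measurable_EFinP.
  - by move=> x _; rewrite lee_fin.
  rewrite [X in _ + X]EFinM -IB -ge0_integralZl//; last 2 first.
  - exact/measurable_EFinP.
  - by move=> x _; rewrite lee_fin.
  rewrite -ge0_integralD//; last 4 first.
  - by move=> x _; exact: hellinger_ge0.
  - exact: measurable_hellinger.
  - by move=> x _; rewrite mule_ge0// lee_fin.
  - by apply: measurable_funeM; exact/measurable_EFinP.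
  apply: ge0_le_integral => //.
  - by move=> x _; rewrite mule_ge0// lee_fin.
  - by apply: measurable_funeM; exact/measurable_EFinP.
  - apply: emeasurable_funD; first exact: measurable_hellinger.
    by apply: measurable_funeM; exact/measurable_EFinP.
  - by move=> x _; rewrite -!EFinM; exact: hellinger_tangent.
move: a0; rewrite le_eqVlt => /predU1P[<-|a0].
  by rewrite /hellinger (epow0_pos al0) mul0e integral_ge0// => x _; exact: hellinger_ge0.
move: b0; rewrite le_eqVlt => /predU1P[b0|b0]; last first.
  have := tangent _ (divr_ge0 (ltW a0) (ltW b0)).
  rewrite -leeBlDr// -EFinB; apply: le_trans.
  by rewrite /hellinger !epow_fin// -EFinM lee_fin tangent_at_ratio// ltW.
suff -> : \int[m]_x hellinger alpha (A x) (B x) = +oo by rewrite leey.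
move: tangent; rewrite -b0.
have : 0 <= \int[m]_x hellinger alpha (A x) (B x).
  by apply: integral_ge0 => x _; exact: hellinger_ge0.
case: (\int[m]_x _) => [r| |] // r0 tangent.
exfalso; rewrite lee_fin in r0.
(* The slope is chosen so that the tangent bound equals r + 1. *)
pose v := ((r + 1) / (alpha * a))%R.
have v0 : (0 < v)%R by rewrite divr_gt0 ?mulr_gt0// ltr_wpDl.
have := tangent (v `^ ((alpha - 1)^-1))%R (powR_ge0 _ _).
rewrite mulr0 adde0 lee_fin -powRrM mulVf ?gt_eqF// powRr1 ?(ltW v0)//.
have -> : (alpha * v * a = r + 1)%R by rewrite /v; field; rewrite !gt_eqF.
by apply/negP; rewrite -ltNge ltrDl.
Qed.

End jensen.

(** Jensen's inequality holds here for any measure [m], not only for a probability,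
    because [hellinger] is homogeneous besides being convex. *)
Lemma hellinger_jensen (R : realType) d (T : measurableType d)
    (m : {measure set T -> \bar R}) (A B : T -> R) (alpha a b : R) :
  alpha \notin `[0%R, 1%R] ->
  measurable_fun [set: T] A -> measurable_fun [set: T] B ->
  (forall x, (0 <= A x)%R) -> (forall x, (0 <= B x)%R) ->
  \int[m]_x (A x)%:E = a%:E -> \int[m]_x (B x)%:E = b%:E ->
  hellinger alpha a b <= \int[m]_x hellinger alpha (A x) (B x).
Proof.
move=> /notin_itv01P[al0|al1] mA mB A0 B0 IA IB; last exact: hellinger_jensen_gt1.
rewrite -hellinger_sym; under eq_integral do rewrite -hellinger_sym.
by apply: hellinger_jensen_gt1 => //; rewrite ltrDl oppr_gt0.
Qed.

(** * Densities, and integrals of nonmeasurable or signed functions *)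

Section density.
Context d (T : measurableType d) (R : realType).
Variables (mu rho : {measure set T -> \bar R}) (p : T -> R).
Hypotheses (mp : measurable_fun [set: T] p) (p0 : forall x, (0 <= p x)%R).
Hypothesis rhoE : forall A, measurable A -> rho A = \int[mu]_(x in A) (p x)%:E.

Import HBNNSimple.

Let integral_density_nnsfun (h : {nnsfun T >-> R}) :
  \int[rho]_x (h x)%:E = \int[mu]_x ((h x)%:E * (p x)%:E).
Proof.
have mind (y : R) : measurable_fun [set: T]
    (fun x => (y * \1_(h @^-1` [set y]) x)%:E).
  by apply/measurable_EFinP; exact: measurable_funM.
have meq : measurable_fun [set: T] (fun x => (p x)%:E).
  exact/measurable_EFinP.
transitivity (\int[rho]_x
   (\sum_(y \in range h) (y * \1_(h @^-1` [set y]) x)%:E)).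
  by apply: eq_integral => t tE; rewrite /= [in LHS]fimfunE -fsumEFin.
rewrite ge0_integral_fsum//; last by move=> m y Ey; exact: nnfun_muleindic_ge0.
transitivity (\int[mu]_x (\sum_(y \in range h)
    (y * \1_(h @^-1` [set y]) x)%:E * (p x)%:E)); last first.
  apply: eq_integral => x _.
  rewrite -ge0_mule_fsuml => [|y]; last exact: nnfun_muleindic_ge0.
  by rewrite fsumEFin// -(fimfunE _ x).
rewrite ge0_integral_fsum//; last 2 first.
  - by move=> y; apply: emeasurable_funM => //; exact: meq.
  - by move=> m y Ey; apply: mule_ge0; [exact: nnfun_muleindic_ge0|rewrite lee_fin].
apply: eq_fsbigr => r rhn.
under eq_integral do rewrite EFinM.
rewrite integralZl_indic_nnsfun => //.
under [RHS]eq_integral do rewrite EFinM -muleA.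
have r0 : (0 <= r)%R.
  by move: rhn; rewrite inE => -[x _ <-]; exact: fun_ge0.
rewrite ge0_integralZl//.
- rewrite integral_indic// setIT rhoE// integral_mkcond.
  congr (_ * _); apply: eq_integral => x xE.
  by rewrite epatch_indic muleC.
- apply: emeasurable_funM; exact/measurable_EFinP.
- by move=> x _; rewrite mule_ge0// lee_fin.
Qed.

(** The density is real-valued so that multiplication by it commutes with the
    approximation of [g] by simple functions. *)
Lemma integral_density (g : T -> \bar R) : (forall x, 0 <= g x) ->
  measurable_fun [set: T] g ->
  \int[rho]_x g x = \int[mu]_x (g x * (p x)%:E).
Proof.
move=> g0 mg; pose h := nnsfun_approx measurableT mg.
have hE x : (h n x)%:E @[n --> \oo] --> g x by exact: cvg_nnsfun_approx.
have h_nd x : {homo (fun n => (h n x)%:E) : a b / (a <= b)%N >-> a <= b}.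
  by move=> a b ab; rewrite lee_fin; exact/lefP/nd_nnsfun_approx.
transitivity (limn (fun n => \int[rho]_x (h n x)%:E)).
  rewrite -monotone_convergence//.
  - by apply: eq_integral => x _; apply/esym/cvg_lim.
  - by move=> n; apply/measurable_EFinP.
  - by move=> n x _; rewrite lee_fin.
under eq_fun do rewrite integral_density_nnsfun.
rewrite -monotone_convergence//.
- apply: eq_integral => x _; apply/cvg_lim => //.
  exact: cvgeZr.
- by move=> n; apply: emeasurable_funM; apply/measurable_EFinP.
- by move=> n x _; rewrite mule_ge0// lee_fin.
- by move=> x _ a b ab; rewrite lee_wpmul2r ?lee_fin//; exact/lefP/nd_nnsfun_approx.
Qed.

Lemma integral_density_in (g : T -> \bar R) (A : set T) : measurable A ->
  (forall x, 0 <= g x) -> measurable_fun [set: T] g ->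
  \int[rho]_(x in A) g x = \int[mu]_(x in A) (g x * (p x)%:E).
Proof.
move=> mA g0 mg; rewrite integral_mkcond integral_density; last 2 first.
- by move=> x; apply: erestrict_ge0.
- by apply/(measurable_restrictT _ _).1 => //; exact: measurable_funTS.
rewrite [RHS]integral_mkcond; apply: eq_integral => x _.
by rewrite !patchE; case: ifP => //; rewrite mul0e.
Qed.

End density.

Section nonmeasurable.
Context d (T : measurableType d) (R : realType) (mu : {measure set T -> \bar R}).

(** Both integrals are suprema over the simple functions below the integrand, and
    these sets of simple functions are nested. *)
Lemma le_integral_nonmeasurable (f g : T -> \bar R) :
  (forall x, 0 <= f x) -> (forall x, f x <= g x) ->
  \int[mu]_x f x <= \int[mu]_x g x.
Proof.
move=> f0 fg; rewrite !ge0_integralTE//; last by move=> x; exact: le_trans (fg x).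
apply: le_ereal_sup => _ [h hf <-]; exists h => // x.
exact: le_trans (fg x).
Qed.

(** [f] lies between the measurable functions equal to [g] on [E] and to 0,
    respectively [+oo], off [E]. *)
Lemma ae_eq_integral_nonmeasurable (f g : T -> \bar R) (E : set T) :
  measurable E -> mu (~` E) = 0 ->
  (forall x, 0 <= f x) -> (forall x, 0 <= g x) -> measurable_fun [set: T] g ->
  (forall x, E x -> f x = g x) ->
  \int[mu]_x f x = \int[mu]_x g x.
Proof.
move=> mE E0 f0 g0 mg fg.
have mpt (c : \bar R) : measurable_fun [set: T] (fun x => if x \in E then g x else c).
  apply: measurable_fun_ifT => [| |];
    [apply: (measurable_fun_bool true)|exact: mg|exact: measurable_cst].
  rewrite setTI (_ : _ @^-1` _ = E)//.
  by apply/seteqP; split => x /=; [move=> /set_mem|move=> /mem_set].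
have ipt (c : \bar R) : 0 <= c ->
    \int[mu]_x (if x \in E then g x else c) = \int[mu]_x g x.
  move=> c0; apply: ge0_ae_eq_integral => //.
  - by move=> x _; case: ifP.
  - exists (~` E); split => //; first exact: measurableC.
    move=> x /= /not_implyP[_] + Ex; apply.
    by rewrite mem_set.
apply/eqP; rewrite eq_le; apply/andP; split.
- rewrite -(ipt +oo)//; apply: le_integral_nonmeasurable => // x.
  by case: ifPn => [/set_mem/fg ->//|_]; rewrite leey.
- rewrite -(ipt 0)//; apply: le_integral_nonmeasurable => x.
    by case: ifP.
  by case: ifPn => [/set_mem/fg ->//|_].
Qed.

(** [F] may have integral [+oo], so it need not be integrable; but its negative part
    is dominated by [q], which suffices for additivity. *)
Lemma integral_add_nonneg (F : T -> \bar R) (q : T -> R) :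
  measurable_fun [set: T] F -> measurable_fun [set: T] q ->
  (forall x, (0 <= q x)%R) -> \int[mu]_x (q x)%:E < +oo ->
  (forall x, 0 <= F x + (q x)%:E) ->
  \int[mu]_x F x + \int[mu]_x (q x)%:E = \int[mu]_x (F x + (q x)%:E).
Proof.
move=> mF mq q0 qoo Fq0.
have mqE : measurable_fun [set: T] (fun x => (q x)%:E) by exact/measurable_EFinP.
have Fneg : \int[mu]_x F^\- x \is a fin_num.
  rewrite ge0_fin_numE; last by apply: integral_ge0.
  apply: le_lt_trans qoo; apply: ge0_le_integral => //.
  - exact: measurable_funeneg.
  - move=> x _; rewrite funenegE ge_max lee_fin q0 andbT.
    move: (Fq0 x); case: (F x) => [r| |]/= //; last by rewrite leNye.
    by rewrite -EFinD !lee_fin -lerBlDl sub0r.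
have : \int[mu]_x F^\+ x + \int[mu]_x (q x)%:E =
    \int[mu]_x (F x + (q x)%:E) + \int[mu]_x F^\- x.
  rewrite -!ge0_integralD//; last 4 first.
  - exact: emeasurable_funD.
  - exact: measurable_funeneg.
  - exact: measurable_funepos.
  - by move=> x _; rewrite lee_fin.
  apply: eq_integral => x _.
  rewrite funeposE funenegE; move: (Fq0 x).
  case: (F x) => [r _|_|//]; last first.
    by rewrite max_l ?leey// max_r ?leNye//.
  rewrite -EFinN -!EFin_max -!EFinD; congr EFin.
  by case: (leP r 0%R) => ?; case: (leP (- r)%R 0%R) => ?; lra.
rewrite [in X in _ -> X]integralE => H.
rewrite addeAC H addeK//.
Qed.

End nonmeasurable.

(** * Boundary values of the power functions *)

Section limits.
Context (R : realType).
Implicit Type alpha : R.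

Lemma f_at0_gt1 alpha : (1 < alpha)%R -> f_at0 (f_alpha alpha) = (-1)%:E.
Proof.
move=> a1; apply/cvg_lim => //; apply: cvg_EFin.
  by near=> x.
rewrite -[X in _ --> X]add0r; apply: cvgB; last exact: cvg_cst.
by apply: powR_cvg0; rewrite (lt_trans _ a1).
Unshelve. all: by end_near. Qed.

Lemma f_at0_lt0 alpha : (alpha < 0)%R -> f_at0 (f_alpha alpha) = +oo.
Proof.
move=> a0; apply/cvg_lim => //; apply/cvgeyPge => A.
have a0' : (0 < - alpha)%R by rewrite oppr_gt0.
have B0 : (0 < (`|A| + 1)^-1)%R by rewrite invr_gt0 ltr_wpDl.
have /cvgr0Pnorm_lt/(_ _ B0) H := powR_cvg0 a0'.
near=> x.
have x0 : (0 < x)%R by near: x; exact: nbhs_right_gt.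
have : (`|x `^ (- alpha)| < (`|A| + 1)^-1)%R by near: x.
rewrite (ger0_norm (powR_ge0 _ _))// powRN ltf_pV2 ?posrE ?powR_gt0 ?ltr_wpDl// => h.
rewrite lee_fin /f_alpha lerBrDr (le_trans _ (ltW h))// lerD2r.
exact: ler_norm.
Unshelve. all: by end_near. Qed.

Lemma f_slope_oo_gt1 alpha : (1 < alpha)%R -> f_slope_oo (f_alpha alpha) = +oo.
Proof.
move=> a1; apply/cvg_lim => //; apply/cvgeyPge => A.
have am0 : (0 < alpha - 1)%R by rewrite subr_gt0.
pose B := (`|A| + 1)%R.
have B0 : (0 < B)%R by rewrite ltr_wpDl.
near=> x.
have x1 : (1 <= x)%R by near: x; apply: nbhs_pinfty_ge; rewrite num_real.
have x0 : (0 < x)%R by rewrite (lt_le_trans _ x1).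
have xB : (B `^ (alpha - 1)^-1 <= x)%R.
  by near: x; apply: nbhs_pinfty_ge; rewrite num_real.
have h : (B <= x `^ (alpha - 1))%R.
  rewrite -[leLHS](powRr1 (ltW B0)) -[X in (B `^ X)%R](mulVf (lt0r_neq0 am0)) powRrM.
  by apply: ge0_ler_powR; rewrite ?nnegrE ?powR_ge0// ltW.
rewrite lee_fin /f_alpha ler_pdivlMr// lerBrDr.
rewrite -(mulr_powRB1 (ltW x0) (lt_trans ltr01 a1)).
rewrite (le_trans (_ : _ <= B * x)%R)//; last by rewrite mulrC ler_pM2l.
rewrite /B mulrDl mul1r lerD// ler_pM2r// ler_norm//.
Unshelve. all: by end_near. Qed.

Lemma f_slope_oo_lt0 alpha : (alpha < 0)%R -> f_slope_oo (f_alpha alpha) = 0.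
Proof.
move=> a0; apply/cvg_lim => //; apply: cvg_EFin; first by near=> x.
apply/cvgr0Pnorm_le => e e0; near=> x.
have x1 : (1 <= x)%R by near: x; apply: nbhs_pinfty_ge; rewrite num_real.
have x0 : (0 < x)%R by rewrite (lt_le_trans _ x1).
have xe : (e^-1 <= x)%R by near: x; apply: nbhs_pinfty_ge; rewrite num_real.
rewrite normrM normfV (gtr0_norm x0) ler_pdivrMr//.
rewrite (@le_trans _ _ 1%R)//; last by rewrite -ler_pdivrMl// mulr1.
rewrite /f_alpha ler_norml lerBrDr addNr powR_ge0/= lerBlDr.
rewrite -[leRHS]addr0 -[(1 + 1)%R]addr0.
have : (x `^ alpha <= x `^ 0)%R by rewrite ler_powR// ltW.
by rewrite powRr0; lra.
Unshelve. all: by end_near. Qed.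

End limits.

(** * Power divergences as Hellinger integrals *)

(** Where [b] vanishes only the slope at infinity is left, and it is the factor
    [0 `^ (1 - alpha)] of [hellinger]; where [b] does not vanish but [a] does, the
    limit of [f_alpha] at 0 plays the same role for the factor [0 `^ alpha]. *)
Lemma hellinger_f_ext (R : realType) (alpha a b : R) : alpha \notin `[0%R, 1%R] ->
  (0 <= a)%R -> (0 <= b)%R ->
  hellinger alpha a b = f_ext (f_alpha alpha) (a / b) * b%:E + b%:E
    + f_slope_oo (f_alpha alpha) * (if b == 0%R then a%:E else 0).
Proof.
move=> /notin_itv01P ha a0; rewrite le_eqVlt => /predU1P[<-|b0].
  rewrite eqxx mule0 !add0e /hellinger; case: ha => [al0|al1].
    by rewrite f_slope_oo_lt0// mul0e epow0_pos ?mule0// subr_gt0 (lt_trans al0).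
  rewrite f_slope_oo_gt1// epow0_neg ?subr_lt0//.
  move: a0; rewrite le_eqVlt => /predU1P[<-|a0].
    by rewrite epow0_pos ?mul0e ?mule0// (lt_trans _ al1).
  by rewrite epow_fin// gt0_mulye// gt0_muley// lte_fin powR_gt0.
rewrite (gt_eqF b0) mule0 adde0 /hellinger (epow_fin _ b0) /f_ext.
move: a0; rewrite le_eqVlt => /predU1P[<-|a0].
  rewrite mul0r eqxx; case: ha => [al0|al1].
    by rewrite f_at0_lt0// epow0_neg// !gt0_mulye// ?lte_fin ?powR_gt0.
  rewrite f_at0_gt1// epow0_pos ?(lt_trans _ al1)// mul0e.
  by rewrite -EFinM -EFinD mulN1r addNr.
rewrite gt_eqF ?divr_gt0// epow_fin// -!EFinM -EFinD; congr EFin.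
rewrite /f_alpha mulrBl mul1r subrK powRM ?invr_ge0 ?ltW// -mulrA; congr (_ * _)%R.
rewrite -powR_inv1 ?ltW// -powRrM mulN1r -[X in (_ * X)%R]powRr1 ?ltW//.
by rewrite -powRD ?(gt_eqF b0) ?implybT// addrC.
Qed.

(** [y^-1 = y * (y ^+ 2)^-1] reduces the inverse to [powR], whose inverse powers
    agree with those of the ring on nonnegative numbers. *)
Lemma measurable_fun_div (R : realType) d (T : measurableType d) (a b : T -> R) :
  measurable_fun [set: T] a -> measurable_fun [set: T] b ->
  measurable_fun [set: T] (fun x => a x / b x)%R.
Proof.
move=> ma mb.
apply: (eq_measurable_fun (fun x => a x * (b x * (b x * b x) `^ (-1)))%R).
  move=> x _; rewrite powR_inv1 -?expr2 ?sqr_ge0//.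
  have [->|bx0] := eqVneq (b x) 0%R; first by rewrite mul0r invr0.
  by field.
apply: measurable_funM => //; apply: measurable_funM => //.
apply: (measurableT_comp (measurable_powR _)).
exact: measurable_funM.
Qed.

Lemma measurable_f_ext_div (R : realType) d (T : measurableType d) (alpha : R)
    (a b : T -> R) :
  measurable_fun [set: T] a -> measurable_fun [set: T] b ->
  measurable_fun [set: T] (fun x => f_ext (f_alpha alpha) (a x / b x)%R * (b x)%:E).
Proof.
move=> ma mb; apply: emeasurable_funM; last exact/measurable_EFinP.
have mab := measurable_fun_div ma mb.
apply: measurable_fun_ifT; [exact: measurable_fun_eqr|by []|].
apply/measurable_EFinP; apply: measurable_funB => //.
exact: (measurableT_comp (measurable_powR _)).
Qed.

Lemma fdiv_density_hellinger (R : realType) d (X : measurableType d)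
    (lam : {measure set X -> \bar R}) (P : set X -> \bar R) (alpha : R)
    (a b : X -> R) :
  alpha \notin `[0%R, 1%R] ->
  measurable_fun [set: X] a -> measurable_fun [set: X] b ->
  (forall x, (0 <= a x)%R) -> (forall x, (0 <= b x)%R) ->
  (forall A, measurable A -> P A = \int[lam]_(x in A) (a x)%:E) ->
  \int[lam]_x (b x)%:E = 1 ->
  fdiv_density (f_alpha alpha) lam P a b + 1 =
  \int[lam]_x hellinger alpha (a x) (b x).
Proof.
move=> ha ma mb a0 b0 PE b1.
have mS : measurable [set x | b x = 0%R].
  rewrite (_ : [set x | _] = b @^-1` [set 0%R])//.
  by rewrite -[X in measurable X]setTI; exact: mb.
have mF := measurable_f_ext_div alpha ma mb.
have F0 x : 0 <= f_ext (f_alpha alpha) (a x / b x)%R * (b x)%:E + (b x)%:E.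
  have [bx0|bx0] := eqVneq (b x) 0%R; first by rewrite bx0 mule0 adde0.
  have := hellinger_f_ext ha (a0 x) (b0 x).
  by rewrite (negbTE bx0) mule0 adde0 => <-; exact: hellinger_ge0.
have mpatch : measurable_fun [set: X]
    ((fun x => (a x)%:E) \_ [set x | b x = 0%R]).
  apply/(measurable_restrictT _ _).1 => //; apply/measurable_EFinP.
  exact: measurable_funTS.
have patch0 x : 0 <= ((fun x => (a x)%:E) \_ [set x | b x = 0%R]) x.
  by apply: erestrict_ge0 => y _; rewrite lee_fin.
have s0 : 0 <= f_slope_oo (f_alpha alpha).
  by case: (notin_itv01P ha) => al; [rewrite f_slope_oo_lt0|rewrite f_slope_oo_gt1].
rewrite /fdiv_density addeAC -b1 integral_add_nonneg//; last by rewrite b1 ltry.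
rewrite PE// [X in _ * X]integral_mkcond -ge0_integralZl//.
rewrite -ge0_integralD//; last 3 first.
- by apply: emeasurable_funD => //; exact/measurable_EFinP.
- by move=> x _; apply: mule_ge0.
- exact: measurable_funeM.
apply: eq_integral => x _; rewrite hellinger_f_ext//; congr (_ + _ * _).
rewrite patchE; case: ifPn => [/set_mem/= ->|]; first by rewrite eqxx.
by rewrite notin_setE/= => /eqP/negbTE ->.
Qed.

Lemma measure_eq_off_null (R : realType) d (T : measurableType d)
    (m : {measure set T -> \bar R}) (A B N : set T) :
  measurable A -> measurable B -> measurable N -> m N = 0 ->
  (forall x, ~ N x -> A x <-> B x) -> m A = m B.
Proof.
move=> + + mN N0; wlog suff h : A B / measurable A -> measurable B ->
    (forall x, ~ N x -> A x <-> B x) -> m A <= m B.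
  move=> mA mB AB; apply/eqP; rewrite eq_le !h// => x /AB[]; by split.
move=> mA mB AB; apply: (@le_trans _ _ (m (B `|` N))).
  apply: le_measure; rewrite ?inE//; first exact: measurableU.
  move=> x Ax; have [Nx|Nx] := pselect (N x); first by right.
  by left; apply/AB.
by apply: (le_trans (measureU2 _ mB mN)); rewrite [X in _ + X]N0 adde0.
Qed.

Section fdiv_base_change.
Local Open Scope charge_scope.
Context (R : realType) d (X : measurableType d).
Variables (P Q : probability X R).

Lemma psumE A : psum P Q A = P A + Q A.
Proof. by rewrite /psum measure_addE. Qed.

Lemma psum_dominates_l : P `<< psum P Q.
Proof.
apply/null_content_dominatesP => A mA A0.
have : psum P Q A = 0 by exact: A0.
move/eqP; rewrite psumE.
by rewrite padde_eq0 ?measure_ge0// => /andP[/eqP].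
Qed.

Lemma psum_dominates_r : Q `<< psum P Q.
Proof.
apply/null_content_dominatesP => A mA A0.
have : psum P Q A = 0 by exact: A0.
move/eqP; rewrite psumE.
by rewrite padde_eq0 ?measure_ge0// => /andP[_ /eqP].
Qed.

Variables (lam : {measure set X -> \bar R}) (a b : X -> R).
Hypotheses (ma : measurable_fun [set: X] a) (mb : measurable_fun [set: X] b).
Hypotheses (a0 : forall x, (0 <= a x)%R) (b0 : forall x, (0 <= b x)%R).
Hypothesis PE : forall A, measurable A -> P A = \int[lam]_(x in A) (a x)%:E.
Hypothesis QE : forall A, measurable A -> Q A = \int[lam]_(x in A) (b x)%:E.

Let s x := (a x + b x)%R.

Let ms : measurable_fun [set: X] s.
Proof. exact: measurable_funD. Qed.

Let s0 x : (0 <= s x)%R.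
Proof. exact: addr_ge0. Qed.

Let sE A : measurable A -> psum P Q A = \int[lam]_(x in A) (s x)%:E.
Proof.
move=> mA; rewrite psumE PE// QE// -ge0_integralD//.
- by move=> x _; rewrite lee_fin.
- by apply/measurable_EFinP; exact: measurable_funTS.
- by move=> x _; rewrite lee_fin.
- by apply/measurable_EFinP; exact: measurable_funTS.
Qed.

Let divsK (c : X -> R) x : (0 <= c x <= s x)%R -> (c x / s x * s x = c x)%R.
Proof.
have [sx0|sx0] := eqVneq (s x) 0%R; last by rewrite divfK.
by rewrite sx0 mulr0 => /le_anti.
Qed.

Let ratioE (c : X -> R) (rho : probability X R) : measurable_fun [set: X] c ->
  (forall x, (0 <= c x <= s x)%R) ->
  (forall A, measurable A -> rho A = \int[lam]_(x in A) (c x)%:E) ->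
  forall A, measurable A ->
    rho A = \int[psum P Q]_(x in A) (c x / s x)%:E.
Proof.
move=> mc c0 rhoE A mA; rewrite (integral_density_in ms s0 sE)//; last 2 first.
- by move=> x; rewrite lee_fin divr_ge0//; case/andP: (c0 x).
- by apply/measurable_EFinP; exact: measurable_fun_div.
by rewrite rhoE//; apply: eq_integral => x _; rewrite -EFinM divsK.
Qed.

(** The Radon-Nikodym derivative with respect to [psum P Q] may be negative on a null
    set; the ratio [c / s] is a version of it that is nonnegative everywhere. *)
Let ratio_RN (c : X -> R) (rho : probability X R) : rho `<< psum P Q ->
  measurable_fun [set: X] c -> (forall x, (0 <= c x <= s x)%R) ->
  (forall A, measurable A -> rho A = \int[lam]_(x in A) (c x)%:E) ->
  exists N, [/\ measurable N, psum P Q N = 0 & forall x, ~ N x ->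
    fine (('d (charge_of_finite_measure rho) '/d (psum P Q)) x) = (c x / s x)%R].
Proof.
move=> dom mc c0 rhoE.
have [|||N [mN N0 NE]] := @integral_ae_eq _ _ _ (psum P Q) setT measurableT
  (fun x => (c x / s x)%:E) ('d (charge_of_finite_measure rho) '/d (psum P Q)).
- exact: Radon_Nikodym_integrable.
- by apply/measurable_EFinP; exact: measurable_fun_div.
- by move=> E _ mE; rewrite -Radon_Nikodym_integral// -(ratioE mc c0 rhoE mE).
exists N; split => // x Nx.
suff -> : ('d (charge_of_finite_measure rho) '/d (psum P Q)) x = (c x / s x)%:E by [].
by apply: contrapT => h; apply: Nx; apply: NE => /=; apply/not_implyP.
Qed.

(** With respect to [psum P Q], whose density is [s = a + b], the densities of [P]
    and [Q] are [a / s] and [b / s]; by homogeneity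
    [hellinger (a / s) (b / s) * s = hellinger a b]. *)
Lemma fdiv_hellinger (alpha : R) : alpha \notin `[0%R, 1%R] ->
  fdiv (f_alpha alpha) P Q + 1 = \int[lam]_x hellinger alpha (a x) (b x).
Proof.
move=> ha.
have a01 x : (0 <= a x <= s x)%R by rewrite a0 lerDl b0.
have b01 x : (0 <= b x <= s x)%R by rewrite b0 lerDr a0.
have [N [mN N0 NE]] := ratio_RN psum_dominates_l ma a01 PE.
have [M [mM M0 ME]] := ratio_RN psum_dominates_r mb b01 QE.
have mas : measurable_fun [set: X] (fun x => a x / s x)%R.
  by exact: measurable_fun_div.
have mbs : measurable_fun [set: X] (fun x => b x / s x)%R.
  by exact: measurable_fun_div.
have mRN (rho : probability X R) : rho `<< psum P Q -> measurable_fun [set: X]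
    (fun x => fine (('d (charge_of_finite_measure rho) '/d (psum P Q)) x)).
  move=> dom; apply: measurableT_comp => //.
have -> : fdiv (f_alpha alpha) P Q =
    fdiv_density (f_alpha alpha) (psum P Q) P (fun x => a x / s x)%R (fun x => b x / s x)%R.
  rewrite /fdiv /fdiv_density; congr (_ + _ * _).
    apply: ae_eq_integral => //.
    - by apply: measurable_f_ext_div; apply: mRN;
        [exact: psum_dominates_l|exact: psum_dominates_r].
    - exact: measurable_f_ext_div.
    - exists (N `|` M); split; first exact: measurableU.
        by apply: etrans N0; exact: measureU0.
      move=> x /= /not_implyP[_]; apply: contra_notP => /not_orP[Nx Mx].
      by rewrite NE// ME.
  apply: (@measure_eq_off_null _ _ _ P _ _ M) => //.
  - rewrite -[X in measurable X]setTI.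
    exact: (mRN _ psum_dominates_r measurableT [set 0%R]).
  - rewrite -[X in measurable X]setTI.
    exact: (mbs measurableT [set 0%R]).
  - by move/null_content_dominatesP: psum_dominates_l; apply.
  - by move=> x Mx /=; rewrite ME.
rewrite (fdiv_density_hellinger ha)//; last 4 first.
- by move=> x; rewrite divr_ge0.
- by move=> x; rewrite divr_ge0.
- exact: ratioE.
- by rewrite -(ratioE mb b01 QE measurableT) probability_setT.
rewrite (integral_density ms s0 sE)//; last 2 first.
- by move=> x; exact: hellinger_ge0.
- exact: measurable_hellinger.
apply: eq_integral => x _; rewrite -hellinger_homogeneous ?divr_ge0//.
by rewrite !divsK.
Qed.

End fdiv_base_change.
Arguments psum_dominates_l {R d X} P Q.
Arguments psum_dominates_r {R d X} P Q.

(** * Minkowski's inequality for Hellinger integrals of mixtures *)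

(** [M * M^(alpha / (1 - alpha)) = M^(1 / (1 - alpha))]; the inequality is what remains
    of this at [M = +oo]. *)
Lemma epow_normalize (R : realType) (alpha : R) (M : \bar R) :
  alpha \notin `[0%R, 1%R] -> 1 <= M ->
  epow M (1 / (1 - alpha))%R \is a fin_num ->
  epow (fine (epow M (1 / (1 - alpha))%R))%:E alpha * M <=
  epow M (1 / (1 - alpha))%R.
Proof.
move=> ha; have r0 : (1 - alpha)%R != 0%R.
  by case: (notin_itv01P ha) => al; rewrite subr_eq0 eq_sym;
    [rewrite lt_eqF ?(lt_trans al)|rewrite gt_eqF].
case: M => [m| |//]; last first.
  case: (notin_itv01P ha) => al _.
    by rewrite epowy_pos// divr_gt0// subr_gt0 (lt_trans al).
  rewrite epowy_neg/=; last by rewrite mul1r invr_lt0 subr_lt0.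
  by rewrite epow0_pos ?mul0e// (lt_trans _ al).
rewrite lee_fin => m1 _; have m0 : (0 < m)%R by rewrite (lt_le_trans _ m1).
rewrite (epow_fin _ m0)/= epow_fin ?powR_gt0// -EFinM lee_fin -powRrM.
rewrite -[X in (_ * X)%R](powRr1 (ltW m0)) -powRD ?(gt_eqF m0) ?implybT//.
rewrite le_eqVlt; apply/orP; left; apply/eqP; congr (_ `^ _)%R.
by field.
Qed.

Section mixture.
Context (R : realType) d (X : measurableType d) dXi (Xi : measurableType dXi).
Variables (lam : {sigma_finite_measure set X -> \bar R}) (nu : probability Xi R).
Variables (alpha : R) (a : X -> R) (b : Xi -> X -> R) (bbar : X -> R).
Hypothesis ha : alpha \notin `[0%R, 1%R].
Hypothesis ma : measurable_fun [set: X] a.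
Hypothesis mb : measurable_fun [set: Xi * X] (fun z => b z.1 z.2).
Hypothesis mbbar : measurable_fun [set: X] bbar.
Hypothesis a0 : forall x, (0 <= a x)%R.
Hypothesis b0 : forall xi x, (0 <= b xi x)%R.
Hypothesis bbarE : forall x, \int[nu]_xi (b xi x)%:E = (bbar x)%:E.

Let M xi := \int[lam]_x hellinger alpha (a x) (b xi x).
Let N xi := epow (M xi) (1 / (1 - alpha))%R.

Let mhellinger : measurable_fun [set: X * Xi] (fun z => hellinger alpha (a z.1) (b z.2 z.1)).
Proof.
apply: measurable_hellinger.
  exact: (measurableT_comp ma).
exact: (measurableT_comp mb (@measurable_swap _ _ X Xi)).
Qed.

Lemma measurable_hellinger_integral : measurable_fun [set: Xi] M.
Proof.
apply: (@measurable_fun_fubini_tonelli_G _ _ _ _ _ lam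
  (fun z : X * Xi => hellinger alpha (a z.1) (b z.2 z.1))) => // z.
exact: hellinger_ge0.
Qed.

Let mN : measurable_fun [set: Xi] N.
Proof. exact: (measurableT_comp (measurable_epow _)) measurable_hellinger_integral. Qed.

Let N0 xi : 0 <= N xi.
Proof. exact: epow_ge0. Qed.

Let M0 xi : 0 <= M xi.
Proof. by apply: integral_ge0 => x _; exact: hellinger_ge0. Qed.

Hypothesis M1 : {ae nu, forall xi, 1 <= M xi}.

(** Jensen's inequality with the weights [w xi = N xi / n], which integrate to 1, in the
    first argument; they come out of [hellinger] with the power [alpha]. *)
Let hellinger_mixture_fin (n : R) : (0 < n)%R -> \int[nu]_xi N xi = n%:E ->
  \int[lam]_x hellinger alpha (a x) (bbar x) <= (n `^ (1 - alpha))%:E.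
Proof.
move=> n0 IN.
have iN : nu.-integrable [set: Xi] N.
  apply/integrableP; split => //; under eq_integral do rewrite gee0_abs//.
  by rewrite IN ltry.
have mfN : measurable_fun [set: Xi] (fine \o N) by exact: measurableT_comp.
pose w xi := (fine (N xi) / n)%R.
have mw : measurable_fun [set: Xi] w by exact: measurable_funM.
have w0 xi : (0 <= w xi)%R by rewrite divr_ge0 ?fine_ge0// ltW.
have Iw : \int[nu]_xi (w xi)%:E = 1.
  under eq_integral do rewrite EFinM.
  rewrite ge0_integralZr ?lee_fin ?invr_ge0 ?(ltW n0)//; last 2 first.
  - exact/measurable_EFinP.
  - by move=> xi _; rewrite lee_fin fine_ge0.
  rewrite (ae_eq_integral N)//; last 2 first.
  - exact/measurable_EFinP.
  - by apply: filterS (integrable_ae measurableT iN) => xi fN _; rewrite fineK// fN.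
  by rewrite IN -EFinM divff// gt_eqF.
have mf : measurable_fun [set: X * Xi]
    (fun z => hellinger alpha (a z.1 * w z.2) (b z.2 z.1)).
  apply: measurable_hellinger.
    by apply: measurable_funM; [exact: (measurableT_comp ma)|exact: (measurableT_comp mw)].
  exact: (measurableT_comp mb (@measurable_swap _ _ X Xi)).
apply: (@le_trans _ _
    (\int[lam]_x \int[nu]_xi hellinger alpha (a x * w xi) (b xi x))).
  apply: ge0_le_integral => //.
  - by move=> x _; exact: hellinger_ge0.
  - exact: measurable_hellinger.
  - apply: (@measurable_fun_fubini_tonelli_F _ _ _ _ _ nu
      (fun z => hellinger alpha (a z.1 * w z.2) (b z.2 z.1)) mf) => z.
    exact: hellinger_ge0.
  - move=> x _; apply: hellinger_jensen => //.
    + exact: measurable_funM.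
    + exact: (measurableT_comp mb (measurable_pair2 x)).
    + by move=> xi; rewrite mulr_ge0.
    + under eq_integral do rewrite EFinM.
      rewrite ge0_integralZl ?lee_fin//; last 2 first.
      * exact/measurable_EFinP.
      * by move=> xi _; rewrite lee_fin.
      by rewrite Iw mule1.
rewrite (@fubini_tonelli _ _ _ _ _ lam nu
  (fun z => hellinger alpha (a z.1 * w z.2) (b z.2 z.1)) mf)/=; last first.
  by move=> z; exact: hellinger_ge0.
have wM xi : \int[lam]_x hellinger alpha (a x * w xi) (b xi x) =
    epow (w xi)%:E alpha * M xi.
  under eq_integral do rewrite /hellinger epowM// muleAC muleC.
  rewrite ge0_integralZl ?epow_ge0//.
  - apply: (@measurable_hellinger _ alpha _ _ setT a (b xi)) => //.
    exact: (measurableT_comp mb (measurable_pair1 xi)).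
  - by move=> x _; exact: hellinger_ge0.
under eq_integral do rewrite wM.
apply: (@le_trans _ _ (\int[nu]_xi ((n^-1 `^ alpha)%:E * N xi))).
  apply: ae_ge0_le_integral => //.
  - by move=> xi _; rewrite mule_ge0// epow_ge0.
  - apply: emeasurable_funM; last exact: measurable_hellinger_integral.
    by apply: (measurableT_comp (measurable_epow _)); exact/measurable_EFinP.
  - by move=> xi _; rewrite mule_ge0// lee_fin powR_ge0.
  - exact: measurable_funeM.
  - have := integrable_ae measurableT iN; move: M1.
    apply: filterS2 => xi M1xi /(_ I) fN _.
    rewrite /w epowM ?invr_ge0 ?(ltW n0) ?fine_ge0//.
    rewrite [X in _ * X * _](epow_fin _ (_ : 0 < n^-1)%R) ?invr_gt0// muleAC muleC.
    by rewrite lee_wpmul2l ?lee_fin ?powR_ge0// epow_normalize.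
rewrite ge0_integralZl ?lee_fin ?powR_ge0// IN -EFinM lee_fin.
rewrite -(powR_inv1 (ltW n0)) -powRrM mulN1r -[X in (_ * X)%R](powRr1 (ltW n0)).
by rewrite -powRD ?(gt_eqF n0) ?implybT// addrC.
Qed.

(** What is left is [n = 0] and [n = +oo].  Since the Hellinger integrals are at least
    1, [n] can be [+oo] only if [alpha < 0] and 0 only if [alpha > 1], and in both
    cases the right-hand side is [+oo]. *)
Lemma hellinger_mixture : \int[lam]_x hellinger alpha (a x) (bbar x) <=
  epow (\int[nu]_xi epow (\int[lam]_x hellinger alpha (a x) (b xi x))
                         (1 / (1 - alpha))%R) (1 - alpha)%R.
Proof.
rewrite -/(\int[nu]_xi N xi).
have : 0 <= \int[nu]_xi N xi by apply: integral_ge0.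
have nu1 : \int[nu]_xi (cst 1 xi) = 1.
  by rewrite integral_cst// mul1e; exact: probability_setT.
case: (notin_itv01P ha) => al.
- have r0 : (0 < 1 - alpha)%R by rewrite subr_gt0 (lt_trans al).
  have : 1 <= \int[nu]_xi N xi.
    rewrite -nu1; apply: ae_ge0_le_integral => //.
    apply: filterS M1 => xi M1xi _.
    by rewrite -[leLHS](epow1 (1 / (1 - alpha))%R) epow_le// divr_gt0.
  case E : (\int[nu]_xi N xi) => [n| |]//; last by move=> _ _; rewrite epowy_pos// leey.
  rewrite lee_fin => n1 _; have n0 := lt_le_trans ltr01 n1.
  by rewrite epow_fin//; exact: hellinger_mixture_fin.
- have r0 : (1 - alpha < 0)%R by rewrite subr_lt0.
  have : \int[nu]_xi N xi <= 1.
    rewrite -nu1; apply: ae_ge0_le_integral => //.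
    apply: filterS M1 => xi M1xi _.
    by rewrite -[leRHS](epow1 (1 / (1 - alpha))%R) epow_ge// mul1r invr_lt0.
  case E : (\int[nu]_xi N xi) => [n| |]// _.
  rewrite lee_fin le_eqVlt => /predU1P[<-|n0]; first by rewrite epow0_neg// leey.
  by rewrite epow_fin//; exact: hellinger_mixture_fin.
Qed.

End mixture.

(** * Mixtures dominated by an arbitrary measure *)

Lemma psum_density_exists (R : realType) d (X : measurableType d)
    (P Q rho : probability X R) : rho `<< psum P Q ->
  exists a : X -> R, [/\ measurable_fun [set: X] a, forall x, (0 <= a x)%R &
    forall A, measurable A -> rho A = \int[psum P Q]_(x in A) (a x)%:E].
Proof.
move=> dom.
have [f [f0 ffin intf fE]] := radon_nikodym_sigma_finite dom.
exists (fine \o f); split.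
- by apply: measurableT_comp => //; exact: measurable_int intf.
- by move=> x; rewrite fine_ge0.
- by move=> A mA; rewrite fE//; apply: eq_integral => x _; rewrite /= fineK.
Qed.

Lemma fdivD1_ge0 (R : realType) d (X : measurableType d) (P Q : probability X R)
  (alpha : R) : alpha \notin `[0%R, 1%R] -> 0 <= fdiv (f_alpha alpha) P Q + 1.
Proof.
move=> ha.
have [a [ma a0 aE]] := psum_density_exists (psum_dominates_l P Q).
have [b [mb b0 bE]] := psum_density_exists (psum_dominates_r P Q).
rewrite (fdiv_hellinger ma mb a0 b0 aE bE ha); apply: integral_ge0 => x _.
exact: hellinger_ge0.
Qed.

Section density_real.
Context (R : realType) d (X : measurableType d) (mu : {measure set X -> \bar R}).
Variables (P : probability X R) (p : X -> \bar R).
Hypothesis hp : is_density mu p P.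

(** A probability density is finite almost everywhere. *)
Lemma density_fine A : measurable A -> P A = \int[mu]_(x in A) (fine (p x))%:E.
Proof.
move=> mA; case: hp => mp p0 pE.
have ip : mu.-integrable [set: X] p.
  apply/integrableP; split => //; under eq_integral do rewrite gee0_abs//.
  by rewrite -pE// probability_setT ltry.
rewrite pE//; apply: ae_eq_integral => //.
- exact: measurable_funTS.
- by apply/measurable_EFinP; apply: measurable_funTS; exact: measurableT_comp.
- apply: filterS (integrable_ae measurableT ip) => x fp _.
  by rewrite fineK// fp.
Qed.

End density_real.

Section relative_density.
Context (R : realType) d (X : measurableType d) (mu : {measure set X -> \bar R})
  dXi (Xi : measurableType dXi) (Q : Xi -> probability X R)
  (q : Xi -> X -> \bar R) (nu : probability Xi R) (Qbar : probability X R).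
Hypothesis hq : forall xi, is_density mu (q xi) (Q xi).
Hypothesis mq : measurable_fun [set: Xi * X] (fun z => q z.1 z.2).
Hypothesis hQbar : is_density mu (fun x => \int[nu]_xi q xi x) Qbar.

Let qbar x := fine (\int[nu]_xi q xi x).
(* Where qbar is 0 or +oo, its fine is 0 and k vanishes, because 0^-1 = 0. *)
Let k xi x := (fine (q xi x) / qbar x)%R.

Let q0 xi x : 0 <= q xi x. Proof. by case: (hq xi). Qed.

Let mqbar : measurable_fun [set: X] qbar.
Proof. by case: hQbar => m _ _; exact: measurableT_comp. Qed.

Let qbar0 x : (0 <= qbar x)%R.
Proof. by rewrite fine_ge0// integral_ge0. Qed.

Let k0 xi x : (0 <= k xi x)%R.
Proof. by rewrite divr_ge0// fine_ge0. Qed.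

Let mk : measurable_fun [set: Xi * X] (fun z => k z.1 z.2).
Proof.
apply: (@measurable_fun_div _ _ _ (fun z : Xi * X => fine (q z.1 z.2))
  (fun z : Xi * X => qbar z.2)).
  exact: (measurableT_comp _ mq).
exact: (measurableT_comp mqbar).
Qed.

Let mkx xi : measurable_fun [set: X] (k xi).
Proof. exact: (measurableT_comp mk (measurable_pair1 xi)). Qed.

Let S := [set x | qbar x != 0%R].

Let mS : measurable S.
Proof.
rewrite (_ : S = ~` (qbar @^-1` [set 0%R])); last first.
  by apply/seteqP; split => x /= /eqP.
by apply: measurableC; rewrite -[X in measurable X]setTI; exact: mqbar.
Qed.

Let Qbar_S A : measurable A -> Qbar (A `&` S) = Qbar A.
Proof.
move=> mA; rewrite !(density_fine hQbar)//; last exact: measurableI.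
rewrite integral_mkcond [RHS]integral_mkcond; apply: eq_integral => x _.
rewrite !patchE in_setI; case: (x \in A) => //=.
case: ifPn => //; rewrite notin_setE /S/= => /negP/negPn/eqP.
by rewrite -/(qbar x) => ->.
Qed.

Let int_k x : \int[nu]_xi (k xi x)%:E = (\1_S x)%:E.
Proof.
rewrite indicE; have [xS|] := boolP (x \in S); last first.
  rewrite notin_setE /S/= => /negP/negPn/eqP qx0.
  by apply: integral0_eq => xi _; rewrite /k qx0 invr0 mulr0.
have qx0 : qbar x != 0%R by exact: (set_mem xS).
have fq : \int[nu]_xi q xi x \is a fin_num.
  by move: qx0; rewrite /qbar; case: (\int[nu]_xi q xi x) => //=; rewrite eqxx.
have mqx : measurable_fun [set: Xi] (fun xi => q xi x).
  exact: (measurableT_comp mq (measurable_pair2 x)).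
have iq : nu.-integrable [set: Xi] (fun xi => q xi x).
  apply/integrableP; split => //; under eq_integral do rewrite gee0_abs//.
  by rewrite ltey_eq fq.
rewrite /k; under eq_integral do rewrite EFinM.
have mfq : measurable_fun [set: Xi] (fun xi => (fine (q xi x))%:E).
  by apply/measurable_EFinP; exact: measurableT_comp.
rewrite ge0_integralZr// ?lee_fin ?invr_ge0//; last first.
  by move=> xi _; rewrite lee_fin fine_ge0.
rewrite (ae_eq_integral (fun xi => q xi x))//; last first.
  by apply: filterS (integrable_ae measurableT iq) => xi fqx _; rewrite fineK// fqx.
by rewrite -(fineK fq) -EFinM divff.
Qed.

Let k_le xi A : measurable A -> \int[Qbar]_(x in A) (k xi x)%:E <= Q xi A.
Proof.
move=> mA.
rewrite (integral_density_in mqbar qbar0 (density_fine hQbar))//; last 2 first.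
- by move=> x; rewrite lee_fin.
- exact/measurable_EFinP.
rewrite (density_fine (hq xi) mA); have [mqx _ _] := hq xi.
apply: ge0_le_integral => //.
- by move=> x _; rewrite mule_ge0 ?lee_fin.
- apply: measurable_funTS; apply: emeasurable_funM; exact/measurable_EFinP.
- by apply: measurable_funTS; apply/measurable_EFinP; exact: measurableT_comp.
- move=> x _; rewrite -EFinM lee_fin /k.
  have [->|qx0] := eqVneq (qbar x) 0%R; first by rewrite mulr0 fine_ge0.
  by rewrite divfK.
Qed.

Let E := [set xi | \int[Qbar]_x (k xi x)%:E = 1].

Let mint_k : measurable_fun [set: Xi] (fun xi => \int[Qbar]_x (k xi x)%:E).
Proof.
apply: (@measurable_fun_fubini_tonelli_F _ _ _ _ _ Qbar
  (fun z : Xi * X => (k z.1 z.2)%:E)) => //; first exact/measurable_EFinP.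
by move=> z; rewrite lee_fin.
Qed.

Let mE : measurable E.
Proof.
rewrite (_ : E = (fun xi => \int[Qbar]_x (k xi x)%:E) @^-1` [set 1])//.
by rewrite -[X in measurable X]setTI; exact: mint_k.
Qed.

(** Tonelli's theorem on [nu] and [Qbar]: the functions [xi |-> \int k xi dQbar] are at
    most 1 and have average 1. *)
Let nuE : nu (~` E) = 0.
Proof.
have int_k1 : \int[nu]_xi \int[Qbar]_x (k xi x)%:E = 1.
  rewrite (@fubini_tonelli _ _ _ _ _ nu Qbar (fun z : Xi * X => (k z.1 z.2)%:E))/=;
    last 2 first.
  - exact/measurable_EFinP.
  - by move=> z; rewrite lee_fin.
  under eq_integral do rewrite int_k.
  rewrite integral_indic// setIC.
  exact: etrans (Qbar_S measurableT) (probability_setT _).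
have ik : nu.-integrable [set: Xi] (fun xi => \int[Qbar]_x (k xi x)%:E).
  apply/integrableP; split => //; under eq_integral.
    move=> xi _; rewrite gee0_abs; last by apply: integral_ge0 => x _; rewrite lee_fin.
    over.
  by rewrite int_k1 ltry.
have i1 : nu.-integrable [set: Xi] (cst 1).
  exact: finite_measure_integrable_cst.
have k1 xi : \int[Qbar]_x (k xi x)%:E <= 1.
  by rewrite (le_trans (k_le xi measurableT))// probability_setT.
have fk xi : \int[Qbar]_x (k xi x)%:E \is a fin_num.
  rewrite ge0_fin_numE; first by rewrite (le_lt_trans (k1 xi))// ltry.
  by apply: integral_ge0 => x _; rewrite lee_fin.
have : \int[nu]_xi `|1 - \int[Qbar]_x (k xi x)%:E| = 0.
  rewrite (eq_integral (fun xi => 1 - \int[Qbar]_x (k xi x)%:E)); last first.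
    by move=> xi _; rewrite gee0_abs// sube_ge0 ?fk// k1.
  rewrite (@integralB _ _ _ nu _ measurableT (cst 1)
    (fun xi => \int[Qbar]_x (k xi x)%:E))//.
  rewrite int_k1 integral_cst// mul1e [X in X - _](_ : _ = 1) ?subee//.
  exact: probability_setT.
move/ae_eq_integral_abs => [//||N [mN N0 NE]].
  exact: emeasurable_funB.
apply: (subset_measure0 _ mN _ N0); first exact: measurableC.
move=> xi nE; apply: NE => /= /(_ I) h; apply: nE; rewrite /E/=.
by move: h; rewrite -(fineK (fk xi)) -EFinB => -[] /eqP; rewrite subr_eq0 => /eqP <-.
Qed.

(** By [k_le], [k xi] times [Qbar] is at most [Q xi] on [A] and on its complement, and for
    [xi] in [E] both have total mass 1. *)
Let QE xi : E xi -> forall A, measurable A ->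
  Q xi A = \int[Qbar]_(x in A) (k xi x)%:E.
Proof.
move=> Exi A mA; apply/eqP; rewrite eq_le k_le// andbT leNgt; apply/negP => h.
have mAc := measurableC mA.
have mkE : measurable_fun [set: X] (fun x => (k xi x)%:E) by exact/measurable_EFinP.
have := Exi; rewrite /E/= -(setUv A) ge0_integral_setU//; last 3 first.
- exact: measurable_funTS.
- by move=> x _; rewrite lee_fin.
- exact/disj_setPCl.
have := probability_setT (Q xi); rewrite -(setUv A) measureU// ?setICr// => <-.
apply/eqP; rewrite lt_eqF//; apply: lte_leD => //; last exact: k_le.
rewrite ge0_fin_numE; last by apply: integral_ge0 => x _; rewrite lee_fin.
by rewrite (le_lt_trans (k_le xi mAc))// ltey_eq fin_num_measure.
Qed.

(** Besides the domination of almost every [Q xi] by [Qbar], this gives the joint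
    measurability that a separate choice of Radon-Nikodym derivative for each [xi]
    would not. *)
Lemma relative_density_exists : exists (k : Xi -> X -> R) (S : set X) (E : set Xi),
  [/\ measurable_fun [set: Xi * X] (fun z => k z.1 z.2) /\
        (forall xi x, (0 <= k xi x)%R),
      measurable S /\ (forall A, measurable A -> Qbar (A `&` S) = Qbar A),
      forall x, \int[nu]_xi (k xi x)%:E = (\1_S x)%:E,
      measurable E /\ nu (~` E) = 0 &
      forall xi, E xi -> forall A, measurable A ->
        Q xi A = \int[Qbar]_(x in A) (k xi x)%:E].
Proof. by exists k, S, E; split. Qed.

End relative_density.

Section fdiv_mixture.
Context (R : realType) d (X : measurableType d) (mu : {measure set X -> \bar R})
  dXi (Xi : measurableType dXi) (Q : Xi -> probability X R)
  (q : Xi -> X -> \bar R) (nu : probability Xi R) (Qbar : probability X R).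
Hypothesis hq : forall xi, is_density mu (q xi) (Q xi).
Hypothesis mq : measurable_fun [set: Xi * X] (fun z => q z.1 z.2).
Hypothesis hQbar : is_density mu (fun x => \int[nu]_xi q xi x) Qbar.

(** The base measure [psum P Qbar] is finite and dominates [P], [Qbar] and almost all of
    the [Q xi]. *)
Lemma fdiv_mixture (alpha : R) (P : probability X R) : alpha \notin `[0%R, 1%R] ->
  fdiv (f_alpha alpha) P Qbar + 1 <=
  epow (\int[nu]_xi epow (fdiv (f_alpha alpha) P (Q xi) + 1) (1 / (1 - alpha))%R)
       (1 - alpha)%R.
Proof.
move=> ha.
have [k [S [E [[mk k0] [mS QbarS] int_k [mE nuE] QE]]]] :=
  relative_density_exists hq mq hQbar.
pose lam := psum P Qbar.
have [a [ma a0 aE]] := psum_density_exists (psum_dominates_l P Qbar).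
have [c [mc c0 cE]] := psum_density_exists (psum_dominates_r P Qbar).
pose b xi x := (k xi x * c x)%R.
(* Both c and its restriction to S are densities of Qbar; the latter is the mixture
   of the b xi at every point, and not only almost everywhere. *)
pose bbar x := (\1_S x * c x)%R.
have mkx xi : measurable_fun [set: X] (k xi).
  exact: (measurableT_comp mk (measurable_pair1 xi)).
have b0 xi x : (0 <= b xi x)%R by rewrite mulr_ge0.
have bbar0 x : (0 <= bbar x)%R by rewrite mulr_ge0.
have mb : measurable_fun [set: Xi * X] (fun z => b z.1 z.2).
  by apply: measurable_funM => //; exact: (measurableT_comp mc).
have mbbar : measurable_fun [set: X] bbar.
  by apply: measurable_funM => //; exact: measurable_indic.
have bbarE x : \int[nu]_xi (b xi x)%:E = (bbar x)%:E.
  under eq_integral do rewrite EFinM.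
  rewrite ge0_integralZr ?lee_fin//; last 2 first.
  - by apply/measurable_EFinP; exact: (measurableT_comp mk (measurable_pair2 x)).
  - by move=> xi _; rewrite lee_fin.
  by rewrite int_k -EFinM.
have bE xi : E xi -> forall A, measurable A -> Q xi A = \int[lam]_(x in A) (b xi x)%:E.
  move=> Exi A mA; rewrite (QE _ Exi)//.
  rewrite (integral_density_in mc c0 cE)//; last exact/measurable_EFinP.
  by move=> x; rewrite lee_fin.
have bbarD A : measurable A -> Qbar A = \int[lam]_(x in A) (bbar x)%:E.
  move=> mA; rewrite -QbarS// setIC -integral_indic//.
  rewrite (integral_density_in mc c0 cE)//.
  by apply/measurable_EFinP; exact: measurable_indic.
have fE xi : E xi -> fdiv (f_alpha alpha) P (Q xi) + 1 =
    \int[lam]_x hellinger alpha (a x) (b xi x).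
  move=> Exi; apply: fdiv_hellinger => //.
  - by apply: measurable_funM.
  - exact: bE.
rewrite (fdiv_hellinger ma mbbar a0 bbar0 aE bbarD ha).
rewrite (@ae_eq_integral_nonmeasurable _ _ _ nu _
  (fun xi => epow (\int[lam]_x hellinger alpha (a x) (b xi x)) (1 / (1 - alpha))%R)
  E)//; last 4 first.
- by move=> xi; exact: epow_ge0.
- by move=> xi; exact: epow_ge0.
- apply: (measurableT_comp (measurable_epow _)).
  exact: measurable_hellinger_integral.
- by move=> xi Exi; rewrite fE.
apply: hellinger_mixture => //.
exists (~` E); split => //; first exact: measurableC.
move=> xi /= h Exi; apply: h.
rewrite -[leLHS](_ : hellinger alpha 1 1 = 1); last by rewrite /hellinger !epow1 mule1.
apply: hellinger_jensen => //.
- by apply: measurable_funM.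
- by rewrite -aE// probability_setT.
- by rewrite -bE// probability_setT.
Qed.

End fdiv_mixture.
Unset Implicit Arguments.

Theorem theorem5p1 (R : realType) (alpha : R)
  (halpha : alpha \notin `[0%R, 1%R])
  (d : measure_display) (X : measurableType d) (mu : {measure set X -> \bar R})
  (dXi : measure_display) (Xi : measurableType dXi)
  (P : probability X R) (p : X -> \bar R) (hp : is_density mu p P)
  (Q : Xi -> probability X R) (q : Xi -> X -> \bar R)
  (hq : forall xi, is_density mu (q xi) (Q xi))
  (mq : measurable_fun [set: Xi * X] (fun z => q z.1 z.2))
  (nu : probability Xi R)
  (Qbar : probability X R)
  (hQbar : is_density mu (fun x => \int[nu]_xi q xi x) Qbar) :
  fdiv (f_alpha alpha) P Qbar <=
    epow (\int[nu]_xi epow (fdiv (f_alpha alpha) P (Q xi) + 1) (1 / (1 - alpha))%R)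
         (1 - alpha)%R - 1
  /\
  (forall (dT : measure_display) (Theta : measurableType dT)
     (w : probability Theta R) (Pf : Theta -> probability X R)
     (dom : forall theta, Pf theta `<< mu)
     (mD : forall Q' : probability X R,
        measurable_fun [set: Theta] (fun theta => fdiv (f_alpha alpha) (Pf theta) Q'))
     (mB : measurable_fun [set: Theta] (fun theta =>
        epow (\int[nu]_xi
                epow (fdiv (f_alpha alpha) (Pf theta) (Q xi) + 1) (1 / (1 - alpha))%R)
             (1 - alpha)%R)),
   f_informativity (f_alpha alpha) w Pf <=
     \int[w]_theta
       epow (\int[nu]_xi
               epow (fdiv (f_alpha alpha) (Pf theta) (Q xi) + 1) (1 / (1 - alpha))%R)
            (1 - alpha)%R
     - 1).
Proof.
have mix P' := fdiv_mixture hq mq hQbar P' halpha.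
split; first by rewrite leeBrDr.
move=> dT Theta w Pf dom mD mB.
apply: (@le_trans _ _ (\int[w]_theta fdiv (f_alpha alpha) (Pf theta) Qbar)).
  by apply: ereal_inf_lbound; exists Qbar.
rewrite leeBrDr//.
have w1 : \int[w]_theta 1 = 1.
  by rewrite integral_cst// mul1e; exact: probability_setT.
rewrite -[X in _ + X]w1 (integral_add_nonneg (q := cst 1%R))//; last 2 first.
- by rewrite w1 ltry.
- by move=> theta; exact: fdivD1_ge0.
apply: ge0_le_integral => //.
- by move=> theta _; exact: fdivD1_ge0.
- by apply: (emeasurable_funD (mD _)); exact/measurable_EFinP.
Qed.
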